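(* Let $\mathbb{F}$ be a field with characteristic $\mathrm{char}(\mathbb{F})$ and let $n$ be a positive integer with $n\neq \mathrm{char}(\mathbb{F})$ and $n\neq\mathrm{char}(\mathbb{F})-1$. Then, up to isomorphism of Lie algebras, the Lie algebra retracts of the matrix Lie affgebras are as follows: for every element $\mathbf{o}$ of the respective Lie affgebra, $$L(\mathrm{gna}(n,\mathbb{F});\mathbf{o})\cong \mathrm{gl}(n,\mathbb{F}),\qquad L(\mathrm{sna}(n,\mathbb{F});\mathbf{o})\cong \mathrm{sl}(n,\mathbb{F}),$$ $$L(\mathrm{ona}(n);\mathbf{o})\cong \mathrm{o}(n),\qquad L(\mathrm{una}(n);\mathbf{o})\cong \mathrm{u}(n),\qquad L(\mathrm{suna}(n);\mathbf{o})\cong \mathrm{su}(n),$$ where the first two are isomorphisms of Lie algebras over $\mathbb{F}$ and the last three are isomorphisms of Lie algebras over $\mathbb{R}$.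
   Context: **Affine spaces.** An affine space over a field $\mathbb{F}$ is a set $A$ with a ternary operation $\langle -,-,-\rangle: A\times A\times A\to A$ and a map $\mathbb{F}\times A\times A\to A$, $(\alpha,a,b)\mapsto \alpha\triangleright_a b$, such that for all $a,b,c,d,e\in A$, $\alpha,\beta,\gamma\in\mathbb{F}$: $\langle\langle a,b,c\rangle,d,e\rangle=\langle a,b,\langle c,d,e\rangle\rangle$; $\langle a,b,b\rangle=a=\langle b,b,a\rangle$; $\langle a,b,c\rangle=\langle c,b,a\rangle$; $(\alpha-\beta+\gamma)\triangleright_a b=\langle\alpha\triangleright_a b,\beta\triangleright_a b,\gamma\triangleright_a b\rangle$; $\alpha\triangleright_a\langle b,c,d\rangle=\langle\alpha\triangleright_a b,\alpha\triangleright_a c,\alpha\triangleright_a d\rangle$; $(\alpha\beta)\triangleright_a b=\alpha\triangleright_a(\beta\triangleright_a b)$; $1\triangleright_a b=b$; $0\triangleright_a b=a$; $\alpha\triangleright_a b=\langle\alpha\triangleright_c b,\alpha\triangleright_c a,a\rangle$. Bracketing of iterated ternary operations is irrelevant, so one writes $\langle a,b,c,d,e\rangle$ for $\langle\langle a,b,c\rangle,d,e\rangle$. An affine transformation is a map $f:A\to B$ with $f(\langle a,b,c\rangle)=\langle f(a),f(b),f(c)\rangle$ and $f(\alpha\triangleright_a b)=\alpha\triangleright_{f(a)}f(b)$. **Lie affgebras.** A Lie bracket on an affine space $A$ is a binary operation $[-,-]:A\times A\to A$ such that (a) for every $a\in A$ both $[a,-]$ and $[-,a]$ are affine transformations $A\to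 A$; (b) $\langle[a,b],[a,a],[b,a]\rangle=[b,b]$ for all $a,b\in A$; (c) $\langle[a,[b,c]],[a,a],[b,[c,a]],[b,b],[c,[a,b]]\rangle=[c,c]$ for all $a,b,c\in A$. An affine space with a Lie bracket is a Lie affgebra. **Lie algebra retract.** For a Lie affgebra $A$ over $\mathbb{F}$ and $o\in A$, the Lie algebra retract $L(A;o)$ of $A$ at $o$ is the following Lie algebra over $\mathbb{F}$: its underlying set is $A$; its vector space structure has zero element $o$, addition $a+b=\langle a,o,b\rangle$, negatives $-a=\langle o,a,o\rangle$ and scalar multiplication $\alpha a=\alpha\triangleright_o a$; its Lie bracket is $[a,b]_o=\langle[a,b],[a,o],[o,o],[o,b],o\rangle$. It is known that this is a Lie algebra and that retracts of $A$ at different elements are isomorphic. **Structure on matrices.** All sets of matrices called Lie affgebras here carry the operations $\langle\mathbf{a},\mathbf{b},\mathbf{c}\rangle=\mathbf{a}-\mathbf{b}+\mathbf{c}$, $\alpha\triangleright_{\mathbf{a}}\mathbf{b}=\alpha\mathbf{b}-\alpha\mathbf{a}+\mathbf{a}$, and the affine commutator Lie bracket $[\mathbf{a},\mathbf{b}]=\mathbf{a}\mathbf{b}-\mathbf{b}\mathbf{a}+\mathbf{b}$. **Classical Lie algebras** (with the usual commutator bracket $\mathbf{x}\mathbf{y}-\mathbf{y}\mathbf{x}$). $\mathrm{gl}(n,\mathbb{F})$: all $n\times n$ matrices over $\mathbb{F}$; $\mathrm{sl}(n,\mathbb{F})$: those of trace zero; $\mathrm{o}(n)$: real anti-symmetric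 $n\times n$ matrices; $\mathrm{u}(n)$: complex anti-hermitian $n\times n$ matrices; $\mathrm{su}(n)$: traceless complex anti-hermitian $n\times n$ matrices. **Matrix Lie affgebras** (for a positive integer $n$, all indices run over $1,\dots,n+1$): - $\mathrm{gna}(n,\mathbb{F})=\{\mathbf{a}=(a_{kl})\in\mathrm{gl}(n+1,\mathbb{F}) : \sum_k a_{kl}=\sum_k a_{lk}=1\ \forall l\}$; - $\mathrm{sna}(n,\mathbb{F})=\{\mathbf{a}\in\mathrm{gna}(n,\mathbb{F}) : \mathrm{tr}\,\mathbf{a}=0\}$; - $\mathrm{ona}(n)=\{\mathbf{a}\in\mathrm{gna}(n,\mathbb{R}) : a_{kk}=1\ \forall k,\ a_{kl}=-a_{lk}\ \forall k\neq l\}$; - $\mathrm{una}(n)=\{\mathbf{a}\in\mathrm{gl}(n+1,\mathbb{C}) : \sum_k a_{kl}=\sum_k a_{lk}=i\ \forall l,\ a_{lm}=-\overline{a_{ml}}\ \forall l,m\}$, where $i$ is the imaginary unit; - $\mathrm{suna}(n)=\{\mathbf{a}\in\mathrm{una}(n) : \mathrm{tr}\,\mathbf{a}=0\}$. The first two are Lie affgebras over $\mathbb{F}$, the last three over $\mathbb{R}$.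
   Formalization: The condition n ≠ char(F) − 1 is strengthened to: char(F) does not divide n+1 (n+1 is nonzero in F). Otherwise the gna and sna isomorphisms fail, e.g. for F = F_2, n = 3; the last three do not involve F and still follow for every n by taking F of characteristic 0. *)

(* Defs.v *)
From HB Require Import structures.
From mathcomp Require Import all_boot all_order all_algebra.
From mathcomp Require Import complex reals.

Set Implicit Arguments.
Unset Strict Implicit.
Unset Printing Implicit Defensive.

Import GRing.Theory Num.Theory.
Local Open Scope ring_scope.

(* Identities valid in every abelian group: [a = b] is turned into a
   right-nested sum equal to 0, whose terms are cancelled from the head. *)
Section Zmod.
Variable V : zmodType.
Implicit Types a b r s : V.
Fact zmod_start a b : a - b + 0 = 0 -> a = b.
Proof. by rewrite addr0 => /eqP; rewrite subr_eq0 => /eqP. Qed.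
Fact zmod_next a b r s : r = a + s -> b + r = a + (b + s).
Proof. by move=> ->; rewrite addrCA. Qed.
Fact zmod_pos a r s : r = - a + s -> s = 0 -> a + r = 0.
Proof. by move=> -> ->; rewrite addr0 subrr. Qed.
Fact zmod_neg a r s : r = a + s -> s = 0 -> - a + r = 0.
Proof. by move=> -> ->; rewrite addr0 addNr. Qed.
End Zmod.

Ltac zmod_find :=
  match goal with
  | |- ?a + _ = ?b + _ => unify a b; reflexivity
  | |- _ + _ = _ => refine (zmod_next _ _); zmod_find
  end.
Ltac zmod_cancel :=
  lazymatch goal with
  | |- - ?a + _ = 0 => refine (zmod_neg _ _); [zmod_find | zmod_cancel]
  | |- _ + _ = 0 => refine (zmod_pos _ _); [zmod_find | zmod_cancel]
  | |- _ => reflexivity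
  end.
Ltac zmod :=
  apply: zmod_start; rewrite ?(opprD, opprK, oppr0, sub0r) -?addrA ?add0r;
  zmod_cancel.

HB.mixin Record Lmodule_isLieAlgebra (F : fieldType) L of GRing.Lmodule F L := {
  lie : L -> L -> L;
  lie_linearl : forall y : L, linear (lie^~ y);
  lie_linearr : forall x : L, linear (lie x);
  liexx : forall x : L, lie x x = 0;
  lie_jacobi : forall x y z : L,
    lie x (lie y z) + lie y (lie z x) + lie z (lie x y) = 0
}.

#[short(type="lieAlgType")]
HB.structure Definition LieAlgebra (F : fieldType) :=
  {L of GRing.Lmodule F L & Lmodule_isLieAlgebra F L}.

Definition lie_isomorphic (F : fieldType) (L1 L2 : lieAlgType F) : Prop :=
  exists f : {linear L1 -> L2},
    bijective f /\ (forall x y : L1, f (lie x y) = lie (f x) (f y)).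

(* [tern a b c] is <a, b, c> and [act k a b] is the action of the scalar [k]
   on [b] based at [a]. *)
HB.mixin Record Choice_isAffine (F : fieldType) A of Choice A := {
  tern : A -> A -> A -> A;
  act : F -> A -> A -> A;
  ternA : forall a b c d e : A, tern (tern a b c) d e = tern a b (tern c d e);
  ternKr : forall a b : A, tern a b b = a;
  ternKl : forall a b : A, tern b b a = a;
  ternC : forall a b c : A, tern a b c = tern c b a;
  actDl : forall (x y z : F) (a b : A),
    act (x - y + z) a b = tern (act x a b) (act y a b) (act z a b);
  actDr : forall (x : F) (a b c d : A),
    act x a (tern b c d) = tern (act x a b) (act x a c) (act x a d);
  actM : forall (x y : F) (a b : A), act (x * y) a b = act x a (act y a b);
  act1 : forall a b : A, act 1 a b = b;
  act0 : forall a b : A, act 0 a b = a;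
  act_base : forall (x : F) (a b c : A),
    act x a b = tern (act x c b) (act x c a) a
}.

#[short(type="affineType")]
HB.structure Definition Affine (F : fieldType) :=
  {A of Choice A & Choice_isAffine F A}.

Arguments tern {F A} a b c : rename.
Arguments act {F A} k a b : rename.

Definition affine_map (F : fieldType) (A B : affineType F) (f : A -> B) : Prop :=
  (forall a b c : A, f (tern a b c) = tern (f a) (f b) (f c)) /\
  (forall (x : F) (a b : A), f (act x a b) = act x (f a) (f b)).

HB.mixin Record Affine_isLieAffgebra (F : fieldType) A of Affine F A := {
  abr : A -> A -> A;
  abr_affiner : forall a : A, affine_map (abr a : A -> A);
  abr_affinel : forall a : A, affine_map (abr^~ a : A -> A);
  abr_anti : forall a b : A, tern (abr a b) (abr a a) (abr b a) = abr b b;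
  abr_jacobi : forall a b c : A,
    tern (tern (abr a (abr b c)) (abr a a) (abr b (abr c a)))
         (abr b b) (abr c (abr a b)) = abr c c
}.

#[short(type="lieAffgebraType")]
HB.structure Definition LieAffgebra (F : fieldType) :=
  {A of Affine F A & Affine_isLieAffgebra F A}.

Definition retract (F : fieldType) (A : lieAffgebraType F) (o : A) : Type := A.

Section Retract.
Variables (F : fieldType) (A : lieAffgebraType F) (o : A).
Implicit Types a b c : A.

HB.instance Definition _ := Choice.copy (retract o) A.

Definition retract_add a b : A := tern a o b.
Definition retract_opp a : A := tern o a o.
Definition retract_scale (x : F) a : A := act x o a.
Definition retract_lie a b : A :=
  tern (tern (abr a b) (abr a o) (abr o o)) (abr o b) o.

Fact retract_addA : associative retract_add.
Proof. by move=> a b c; rewrite /retract_add ternA. Qed.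
Fact retract_addC : commutative retract_add.
Proof. by move=> a b; rewrite /retract_add ternC. Qed.
Fact retract_add0 : left_id o retract_add.
Proof. by move=> a; rewrite /retract_add ternKl. Qed.
Fact retract_addN : left_inverse o retract_opp retract_add.
Proof. by move=> a; rewrite /retract_add /retract_opp ternA ternKl ternKr. Qed.

HB.instance Definition _ := GRing.isZmodule.Build (retract o)
  retract_addA retract_addC retract_add0 retract_addN.

Fact retract_scaleA (x y : F) a :
  retract_scale x (retract_scale y a) = retract_scale (x * y) a.
Proof. by rewrite /retract_scale actM. Qed.
Fact retract_scale1 : left_id 1 retract_scale.
Proof. by move=> a; rewrite /retract_scale act1. Qed.
Fact act_fix (x : F) : act x o o = o.
Proof. by rewrite -{2}(act0 (F := F) o o) -actM mulr0 act0. Qed.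
Fact retract_scaleDr : right_distributive retract_scale retract_add.
Proof. by move=> x a b; rewrite /retract_scale /retract_add actDr act_fix. Qed.
Fact retract_scaleDl a :
  {morph retract_scale^~ a : x y / x + y >-> retract_add x y}.
Proof.
by move=> x y; rewrite /retract_scale /retract_add -[x in LHS]subr0 actDl act0.
Qed.

HB.instance Definition _ := GRing.Zmodule_isLmodule.Build F (retract o)
  retract_scaleA retract_scale1 retract_scaleDr retract_scaleDl.

Fact retract_addE (a b : retract o) : a + b = tern (a : A) o b.
Proof. by []. Qed.

Fact retract_ternE (a b c : retract o) : tern (a : A) b c = a - b + c :> retract o.
Proof.
have oppE : - b = tern o (b : A) o by [].
by rewrite !retract_addE oppE -!ternA ternKr ternA ternKl.
Qed.

Fact retract_actE (x : F) (a b : retract o) :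
  act x (a : A) b = x *: b - x *: a + a :> retract o.
Proof. by rewrite (act_base x (a : A) b o) retract_ternE. Qed.

(* The linear and bilinear parts of the affine bracket, relative to [o]. *)
Let br (a b : retract o) : retract o := abr (a : A) (b : A).
Let s : retract o := br 0 0.

Fact retract_lieE (a b : retract o) :
  retract_lie a b = br a b - br a 0 + s - br 0 b :> retract o.
Proof. by rewrite /retract_lie !retract_ternE addr0. Qed.

Fact retract_affine_lin (f : A -> A) (x : F) (a b : retract o) : affine_map f ->
  f (x *: a + b : retract o) = x *: (f a : retract o) - x *: (f o : retract o)
    + (f b : retract o) :> retract o.
Proof.
move=> [fT fA].
have fD (u v : retract o) :
    f (u + v) = (f u : retract o) - (f o : retract o) + (f v : retract o).
  by rewrite retract_addE fT retract_ternE.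
have fZ : f (x *: a) =
    x *: (f a : retract o) - x *: (f o : retract o) + (f o : retract o).
  by rewrite [x *: a]/(act x o (a : A)) fA retract_actE.
by rewrite fD fZ addrK.
Qed.

Fact br_linr (a : retract o) (x : F) (b c : retract o) :
  br a (x *: b + c) = x *: br a b - x *: br a 0 + br a c.
Proof. exact: (retract_affine_lin x b c (abr_affiner (a : A))). Qed.

Fact br_linl (a : retract o) (x : F) (b c : retract o) :
  br (x *: b + c) a = x *: br b a - x *: br 0 a + br c a.
Proof. exact: (retract_affine_lin x b c (abr_affinel (a : A))). Qed.

Let lb : retract o -> retract o -> retract o := retract_lie.

Fact retract_lie_linearl (y : retract o) : linear (lb^~ y).
Proof.
by move=> x a b; rewrite /lb !retract_lieE !br_linl !(scalerDr, scalerN) -/s; zmod.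
Qed.

Fact retract_lie_linearr (y : retract o) : linear (lb y).
Proof.
by move=> x a b; rewrite /lb !retract_lieE !br_linr !(scalerDr, scalerN) -/s; zmod.
Qed.

Fact retract_liexx (a : retract o) : lb a a = 0.
Proof.
have: br a 0 - br a a + br 0 a = s by rewrite -retract_ternE; apply: abr_anti.
by rewrite /lb retract_lieE => <-; zmod.
Qed.

Fact retract_lie_jacobi (x y z : retract o) :
  lb x (lb y z) + lb y (lb z x) + lb z (lb x y) = 0.
Proof.
pose P (a b c : retract o) := br a (br b c).
have brB (a u v w t : retract o) :
    br a (u - v + w - t) = br a u - br a v + br a w - br a t + br a 0.
  have -> : u - v + w - t = -1 *: v + (-1 *: t + (1 *: w + u)).
    by rewrite !scaleN1r scale1r; zmod.
  by rewrite !br_linr !scaleN1r !scale1r; zmod.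
have lbE (a b c : retract o) : lb a (lb b c) = P a b c - P a b 0 + P a 0 0 - P a 0 c
    - P 0 b c + P 0 b 0 - P 0 0 0 + P 0 0 c.
  by rewrite /lb !retract_lieE !brB /P /s; zmod.
have T (a b c : retract o) :
    P a b c - br a a + P b c a - br b b + P c a b - br c c = 0.
  by apply/eqP; rewrite subr_eq0; apply/eqP; rewrite -!retract_ternE;
    apply: abr_jacobi.
rewrite !lbE.
transitivity
  ((P x y z - br x x + P y z x - br y y + P z x y - br z z)
  - (P x y 0 - br x x + P y 0 x - br y y + P 0 x y - br 0 0)
  - (P x 0 z - br x x + P 0 z x - br 0 0 + P z x 0 - br z z)
  - (P 0 y z - br 0 0 + P y z 0 - br y y + P z 0 y - br z z)
  + (P x 0 0 - br x x + P 0 0 x - br 0 0 + P 0 x 0 - br 0 0)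
  + (P 0 y 0 - br 0 0 + P y 0 0 - br y y + P 0 0 y - br 0 0)
  + (P 0 0 z - br 0 0 + P 0 z 0 - br 0 0 + P z 0 0 - br z z)
  - (P 0 0 0 - br 0 0 + P 0 0 0 - br 0 0 + P 0 0 0 - br 0 0)).
  by clearbody br; zmod.
by rewrite !T !subr0 !addr0.
Qed.

HB.instance Definition _ := Lmodule_isLieAlgebra.Build F (retract o)
  retract_lie_linearl retract_lie_linearr retract_liexx retract_lie_jacobi.

End Retract.

(* Associative algebras without a nontriviality axiom (unlike [algType]), so
   that square matrices of any size are covered. *)
HB.mixin Record Lmodule_isAssocAlgebra (F : fieldType) M
    of GRing.Lmodule F M := {
  amul : M -> M -> M;
  amulA : associative amul;
  amul_linearl : forall b : M, linear (amul^~ b);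
  amul_linearr : forall a : M, linear (amul a)
}.

#[short(type="assocAlgType")]
HB.structure Definition AssocAlgebra (F : fieldType) :=
  {M of GRing.Lmodule F M & Lmodule_isAssocAlgebra F M}.

Section AssocAlgebraTheory.
Variables (F : fieldType) (M : assocAlgType F).
Implicit Types a b c : M.
Fact amulDl a b c : amul (a + b) c = amul a c + amul b c.
Proof. by have := amul_linearl c 1 a b; rewrite !scale1r. Qed.
Fact amulDr a b c : amul a (b + c) = amul a b + amul a c.
Proof. by have := amul_linearr a 1 b c; rewrite !scale1r. Qed.
Fact amulZl (x : F) a b : amul (x *: a) b = x *: amul a b.
Proof.
have amul0 : amul 0 b = 0 by apply: (addrI (amul 0 b)); rewrite -amulDl !addr0.
by have := amul_linearl b x a 0; rewrite !addr0 /= amul0 addr0.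
Qed.
Fact amulZr (x : F) a b : amul a (x *: b) = x *: amul a b.
Proof.
have amul0 : amul a 0 = 0 by apply: (addrI (amul a 0)); rewrite -amulDr !addr0.
by have := amul_linearr a x b 0; rewrite !addr0 /= amul0 addr0.
Qed.
Fact amulNl a b : amul (- a) b = - amul a b.
Proof. by rewrite -scaleN1r amulZl scaleN1r. Qed.
Fact amulNr a b : amul a (- b) = - amul a b.
Proof. by rewrite -scaleN1r amulZr scaleN1r. Qed.
Definition amulE := (amulDl, amulDr, amulZl, amulZr, amulNl, amulNr).
End AssocAlgebraTheory.

Section MatrixAlgebra.
Variables (F : fieldType) (n : nat).
Fact mulmx_linearl (b : 'M[F]_n) : linear ((@mulmx F n n n)^~ b).
Proof. by move=> x a c; rewrite mulmxDl scalemxAl. Qed.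
Fact mulmx_linearr (a : 'M[F]_n) : linear (@mulmx F n n n a).
Proof. by move=> x b c; rewrite mulmxDr scalemxAr. Qed.
HB.instance Definition _ := Lmodule_isAssocAlgebra.Build F 'M[F]_n
  (@mulmxA F n n n n) mulmx_linearl mulmx_linearr.
End MatrixAlgebra.

(* Square complex matrices, as an algebra over the reals. *)
Definition cmatrix (R : realType) (n : nat) : Type := 'M[R[i]]_n.

Section ComplexMatrix.
Local Open Scope complex_scope.
Variables (R : realType) (n : nat).

HB.instance Definition _ := GRing.Zmodule.copy (cmatrix R n) 'M[R[i]]_n.

Definition cmatrix_scale (x : R) (a : cmatrix R n) : cmatrix R n :=
  x%:C *: (a : 'M[R[i]]_n).

Fact cmatrix_scaleA (x y : R) a :
  cmatrix_scale x (cmatrix_scale y a) = cmatrix_scale (x * y) a.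
Proof. by rewrite /cmatrix_scale scalerA rmorphM. Qed.
Fact cmatrix_scale1 : left_id 1 cmatrix_scale.
Proof. by move=> a; rewrite /cmatrix_scale rmorph1 scale1r. Qed.
Fact cmatrix_scaleDr : right_distributive cmatrix_scale +%R.
Proof. by move=> x a b; apply: scalerDr. Qed.
Fact cmatrix_scaleDl a : {morph cmatrix_scale^~ a : x y / x + y}.
Proof. by move=> x y; rewrite /cmatrix_scale rmorphD scalerDl. Qed.

HB.instance Definition _ := GRing.Zmodule_isLmodule.Build R (cmatrix R n)
  cmatrix_scaleA cmatrix_scale1 cmatrix_scaleDr cmatrix_scaleDl.

Definition cmatrix_mul (a b : cmatrix R n) : cmatrix R n :=
  (a : 'M[R[i]]_n) *m b.
Fact cmatrix_mulA : associative cmatrix_mul.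
Proof. exact: mulmxA. Qed.
Fact cmatrix_linearl b : linear (cmatrix_mul^~ b).
Proof. by move=> x a c; apply: mulmx_linearl. Qed.
Fact cmatrix_linearr a : linear (cmatrix_mul a).
Proof. by move=> x b c; apply: mulmx_linearr. Qed.
HB.instance Definition _ := Lmodule_isAssocAlgebra.Build R (cmatrix R n)
  cmatrix_mulA cmatrix_linearl cmatrix_linearr.

End ComplexMatrix.

Definition commutator (F : fieldType) (M : assocAlgType F) (a b : M) : M :=
  amul a b - amul b a.
Definition affine_commutator (F : fieldType) (M : assocAlgType F) (a b : M) : M :=
  amul a b - amul b a + b.

Record lieSubset (F : fieldType) (M : assocAlgType F) := LieSubset {
  lsub_pred :> {pred M};
  lsub_submod : submod_closed lsub_pred;
  lsub_comm : {in lsub_pred &, forall a b, commutator a b \in lsub_pred}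
}.

Definition lsub_type (F : fieldType) (M : assocAlgType F) (S : lieSubset M) : Type :=
  {a : M | a \in S}.

Section LieSubset.
Variables (F : fieldType) (M : assocAlgType F) (S : lieSubset M).

HB.instance Definition _ := GRing.isSubmodClosed.Build F M (lsub_pred S)
  (lsub_submod S).
HB.instance Definition _ := SubChoice.copy (lsub_type S) {a : M | a \in S}.
HB.instance Definition _ :=
  [SubChoice_isSubLmodule of lsub_type S by <:].

Definition lsub_lie (a b : lsub_type S) : lsub_type S :=
  Sub (commutator (val a) (val b)) (lsub_comm (valP a) (valP b)).

Fact lsub_lie_linearl b : linear (lsub_lie^~ b).
Proof.
move=> x a c; apply: val_inj; rewrite raddfD /= /commutator raddfD /=.
by rewrite !amulE !(scalerDr, scalerN); zmod.
Qed.
Fact lsub_lie_linearr b : linear (lsub_lie b).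
Proof.
move=> x a c; apply: val_inj; rewrite raddfD /= /commutator raddfD /=.
by rewrite !amulE !(scalerDr, scalerN); zmod.
Qed.
Fact lsub_liexx a : lsub_lie a a = 0.
Proof. by apply: val_inj; rewrite SubK /commutator subrr raddf0. Qed.
Fact lsub_lie_jacobi a b c :
  lsub_lie a (lsub_lie b c) + lsub_lie b (lsub_lie c a) + lsub_lie c (lsub_lie a b)
    = 0.
Proof.
apply: val_inj; rewrite !raddfD raddf0 /= /commutator.
by rewrite !amulE !amulA; zmod.
Qed.

HB.instance Definition _ := Lmodule_isLieAlgebra.Build F (lsub_type S)
  lsub_lie_linearl lsub_lie_linearr lsub_liexx lsub_lie_jacobi.

End LieSubset.

Record affSubset (F : fieldType) (M : assocAlgType F) := AffSubset {
  asub_pred :> {pred M};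
  asub_tern : {in asub_pred & &, forall a b c, a - b + c \in asub_pred};
  asub_act : forall x : F,
    {in asub_pred &, forall a b, x *: b - x *: a + a \in asub_pred};
  asub_br : {in asub_pred &, forall a b, affine_commutator a b \in asub_pred}
}.

Definition asub_type (F : fieldType) (M : assocAlgType F) (S : affSubset M) : Type :=
  {a : M | a \in S}.

Section AffSubset.
Variables (F : fieldType) (M : assocAlgType F) (S : affSubset M).

HB.instance Definition _ := SubChoice.copy (asub_type S) {a : M | a \in S}.
Implicit Types a b c d e : asub_type S.

Definition asub_ternary a b c : asub_type S :=
  Sub (val a - val b + val c) (asub_tern (valP a) (valP b) (valP c)).
Definition asub_action (x : F) a b : asub_type S :=
  Sub (x *: val b - x *: val a + val a) (asub_act x (valP a) (valP b)).
Definition asub_bracket a b : asub_type S :=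
  Sub (affine_commutator (val a) (val b)) (asub_br (valP a) (valP b)).

Fact asub_ternA a b c d e :
  asub_ternary (asub_ternary a b c) d e = asub_ternary a b (asub_ternary c d e).
Proof. by apply: val_inj => /=; zmod. Qed.
Fact asub_ternKr a b : asub_ternary a b b = a.
Proof. by apply: val_inj => /=; zmod. Qed.
Fact asub_ternKl a b : asub_ternary b b a = a.
Proof. by apply: val_inj => /=; zmod. Qed.
Fact asub_ternC a b c : asub_ternary a b c = asub_ternary c b a.
Proof. by apply: val_inj => /=; zmod. Qed.
Fact asub_actDl (x y z : F) a b : asub_action (x - y + z) a b =
  asub_ternary (asub_action x a b) (asub_action y a b) (asub_action z a b).
Proof. by apply: val_inj => /=; rewrite !(scalerDl, scaleNr); zmod. Qed.
Fact asub_actDr (x : F) a b c d : asub_action x a (asub_ternary b c d) =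
  asub_ternary (asub_action x a b) (asub_action x a c) (asub_action x a d).
Proof. by apply: val_inj => /=; rewrite !(scalerDr, scalerN); zmod. Qed.
Fact asub_actM (x y : F) a b :
  asub_action (x * y) a b = asub_action x a (asub_action y a b).
Proof. by apply: val_inj => /=; rewrite !(scalerDr, scalerN) !scalerA; zmod. Qed.
Fact asub_act1 a b : asub_action 1 a b = b.
Proof. by apply: val_inj => /=; rewrite !scale1r; zmod. Qed.
Fact asub_act0 a b : asub_action 0 a b = a.
Proof. by apply: val_inj => /=; rewrite !scale0r; zmod. Qed.
Fact asub_act_base (x : F) a b c :
  asub_action x a b = asub_ternary (asub_action x c b) (asub_action x c a) a.
Proof. by apply: val_inj => /=; zmod. Qed.

HB.instance Definition _ := Choice_isAffine.Build F (asub_type S)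
  asub_ternA asub_ternKr asub_ternKl asub_ternC asub_actDl asub_actDr
  asub_actM asub_act1 asub_act0 asub_act_base.

Fact asub_affiner a : affine_map (asub_bracket a).
Proof.
split=> [b c d|x b c]; apply: val_inj; rewrite /= /affine_commutator.
  by rewrite !amulE; zmod.
by rewrite !amulE !(scalerDr, scalerN); zmod.
Qed.
Fact asub_affinel a : affine_map (asub_bracket^~ a).
Proof.
split=> [b c d|x b c]; apply: val_inj; rewrite /= /affine_commutator.
  by rewrite !amulE; zmod.
by rewrite !amulE !(scalerDr, scalerN); zmod.
Qed.
Fact asub_anti a b : tern (asub_bracket a b) (asub_bracket a a) (asub_bracket b a)
  = asub_bracket b b.
Proof. by apply: val_inj; rewrite /= /affine_commutator; zmod. Qed.
Fact asub_jacobi a b c :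
  tern (tern (asub_bracket a (asub_bracket b c)) (asub_bracket a a)
             (asub_bracket b (asub_bracket c a)))
       (asub_bracket b b) (asub_bracket c (asub_bracket a b)) = asub_bracket c c.
Proof.
apply: val_inj; rewrite /= /affine_commutator.
by rewrite !amulE !amulA; zmod.
Qed.

HB.instance Definition _ := Affine_isLieAffgebra.Build F (asub_type S)
  asub_affiner asub_affinel asub_anti asub_jacobi.

End AffSubset.

Definition line_sums (K : pzRingType) (m : nat) (s : K) : {pred 'M[K]_m} :=
  fun a => [forall l, (\sum_k a k l == s) && (\sum_k a l k == s)].

Definition gna_pred (n : nat) (F : fieldType) : {pred 'M[F]_n.+1} :=
  line_sums 1.
Arguments gna_pred : clear implicits.
Definition sna_pred (n : nat) (F : fieldType) : {pred 'M[F]_n.+1} :=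
  fun a => (a \in gna_pred n F) && (\tr a == 0).
Arguments sna_pred : clear implicits.
Definition ona_pred (n : nat) (R : realType) : {pred 'M[R]_n.+1} :=
  fun a => [&& a \in gna_pred n R, [forall k, a k k == 1]
             & [forall k, forall l, (k != l) ==> (a k l == - a l k)]].
Arguments ona_pred : clear implicits.
Definition una_pred (n : nat) (R : realType) : {pred cmatrix R n.+1} :=
  fun a : 'M[R[i]]_n.+1 => (a \in line_sums 'i%C)
    && [forall l, forall m, a l m == - ((a m l)^*)%C].
Arguments una_pred : clear implicits.
Definition suna_pred (n : nat) (R : realType) : {pred cmatrix R n.+1} :=
  fun a : 'M[R[i]]_n.+1 => (a \in una_pred n R) && (\tr a == 0).
Arguments suna_pred : clear implicits.

Definition gl_pred (n : nat) (F : fieldType) : {pred 'M[F]_n} := predT.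
Arguments gl_pred : clear implicits.
Definition sl_pred (n : nat) (F : fieldType) : {pred 'M[F]_n} :=
  fun a => \tr a == 0.
Arguments sl_pred : clear implicits.
Definition o_pred (n : nat) (R : realType) : {pred 'M[R]_n} :=
  fun a => a^T == - a.
Arguments o_pred : clear implicits.
Definition u_pred (n : nat) (R : realType) : {pred cmatrix R n} :=
  fun a : 'M[R[i]]_n => map_mx conjc a^T == - a.
Arguments u_pred : clear implicits.
Definition su_pred (n : nat) (R : realType) : {pred cmatrix R n} :=
  fun a : 'M[R[i]]_n => (a \in u_pred n R) && (\tr a == 0).
Arguments su_pred : clear implicits.

Section Closure.

Fact line_sumsP (K : pzRingType) m (s : K) (a : 'M[K]_m) :
  reflect ((const_mx 1 : 'rV_m) *m a = const_mx s
           /\ a *m (const_mx 1 : 'cV_m) = const_mx s) (a \in line_sums s).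
Proof.
apply: (iffP forallP) => [h|[hl hr] l].
  split; apply/matrixP => i j; rewrite !mxE.
    have /andP[/eqP <- _] := h j.
    by apply: eq_bigr => k _; rewrite mxE mul1r.
  have /andP[_ /eqP <-] := h i.
  by apply: eq_bigr => k _; rewrite mxE mulr1.
apply/andP; split; apply/eqP.
  have /matrixP/(_ 0 l) := hl; rewrite !mxE => <-.
  by apply: eq_bigr => k _; rewrite mxE mul1r.
have /matrixP/(_ l 0) := hr; rewrite !mxE => <-.
by apply: eq_bigr => k _; rewrite mxE mulr1.
Qed.

Section LineSums.
Variables (K : comPzRingType) (m : nat) (s : K).
Implicit Types a b c : 'M[K]_m.

Fact line_sums_tern a b c : a \in line_sums s -> b \in line_sums s ->
  c \in line_sums s -> a - b + c \in line_sums s.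
Proof.
move=> /line_sumsP[a1 a2] /line_sumsP[b1 b2] /line_sumsP[c1 c2].
by apply/line_sumsP; rewrite !(mulmxDl, mulmxDr, mulmxN, mulNmx)
  a1 a2 b1 b2 c1 c2 !subrr !add0r.
Qed.

Fact line_sums_act (x : K) a b : a \in line_sums s -> b \in line_sums s ->
  x *: b - x *: a + a \in line_sums s.
Proof.
move=> /line_sumsP[a1 a2] /line_sumsP[b1 b2].
by apply/line_sumsP; rewrite !(mulmxDl, mulmxDr, mulmxN, mulNmx) -!scalemxAl
  -!scalemxAr a1 a2 b1 b2 !subrr !add0r.
Qed.

Fact line_sums_br a b : a \in line_sums s -> b \in line_sums s ->
  a *m b - b *m a + b \in line_sums s.
Proof.
move=> /line_sumsP[a1 a2] /line_sumsP[b1 b2].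
have cst p q : const_mx s = s *: (const_mx 1 : 'M[K]_(p, q)).
  by apply/matrixP => i j; rewrite !mxE mulr1.
apply/line_sumsP; rewrite !(mulmxDl, mulmxDr, mulmxN, mulNmx) !mulmxA a1 b1.
rewrite -!mulmxA a2 b2 !cst -!scalemxAl -!scalemxAr a1 a2 b1 b2.
by rewrite !subrr !add0r.
Qed.
End LineSums.

Fact tr_tern (K : pzRingType) m (a b c : 'M[K]_m) :
  \tr a == 0 -> \tr b == 0 -> \tr c == 0 -> \tr (a - b + c) == 0.
Proof.
by move=> /eqP a0 /eqP b0 /eqP c0; rewrite !raddfD raddfN /= a0 b0 c0 subrr addr0.
Qed.
Fact tr_act (K : pzRingType) m (x : K) (a b : 'M[K]_m) :
  \tr a == 0 -> \tr b == 0 -> \tr (x *: b - x *: a + a) == 0.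
Proof.
move=> /eqP a0 /eqP b0.
by rewrite !raddfD raddfN /= !linearZ /= a0 b0 !mulr0 subrr addr0.
Qed.
Fact tr_comm (K : comPzRingType) m (a b : 'M[K]_m) : \tr (a *m b - b *m a) = 0.
Proof. by rewrite raddfD raddfN /= mxtrace_mulC subrr. Qed.
Fact tr_br (K : comPzRingType) m (a b : 'M[K]_m) :
  \tr b == 0 -> \tr (a *m b - b *m a + b) == 0.
Proof. by move=> /eqP b0; rewrite raddfD /= tr_comm b0 addr0. Qed.

Fact onaE n (R : realType) (a : 'M[R]_n.+1) :
  (a \in ona_pred n R) = (a \in gna_pred n R) && (a^T == 1%:M + 1%:M - a).
Proof.
have -> : (a \in ona_pred n R) = ona_pred n R a by [].
rewrite /ona_pred; congr (_ && _).
apply/andP/eqP => [[/forallP d /forallP s]|/matrixP h].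
  apply/matrixP => i j; rewrite !mxE.
  have [->|ne] := eqVneq i j; first by rewrite (eqP (d j)) /= addrK.
  by have /forallP/(_ i) := s j; rewrite eq_sym ne /= !add0r => /eqP.
split; apply/forallP => k.
  have e := h k k; rewrite !mxE eqxx /= in e.
  have : (a k k - 1) * 2%:R == 0.
    by rewrite mulr_natr mulr2n {1}e; apply/eqP; zmod.
  by rewrite mulf_eq0 pnatr_eq0 orbF subr_eq0.
apply/forallP => l; apply/implyP => ne.
by have := h l k; rewrite !mxE eq_sym (negPf ne) /= !add0r => ->.
Qed.

Fact unaE n (R : realType) (a : 'M[R[i]]_n.+1) :
  (a \in una_pred n R) = (a \in line_sums 'i%C) && (map_mx conjc a^T == - a).
Proof.
congr (_ && _); apply/forallP/eqP => [h|/matrixP h l].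
  apply/matrixP => i j; rewrite !mxE; have /forallP/(_ j)/eqP -> := h i.
  by rewrite opprK.
by apply/forallP => m; have := h l m; rewrite !mxE => ->; rewrite opprK.
Qed.
End Closure.

Section Examples.
Variables (n : nat) (F : fieldType) (R : realType).

Fact gna_tern : {in gna_pred n F & &, forall a b c, a - b + c \in gna_pred n F}.
Proof. by move=> a b c; apply: line_sums_tern. Qed.
Fact gna_act (x : F) :
  {in gna_pred n F &, forall a b, x *: b - x *: a + a \in gna_pred n F}.
Proof. by move=> a b; apply: line_sums_act. Qed.
Fact gna_br : {in gna_pred n F &, forall a b, affine_commutator a b \in gna_pred n F}.
Proof. by move=> a b; apply: line_sums_br. Qed.

Fact sna_tern : {in sna_pred n F & &, forall a b c, a - b + c \in sna_pred n F}.
Proof.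
move=> a b c /andP[ga ta] /andP[gb tb] /andP[gc tc]; apply/andP.
by split; [apply: gna_tern | apply: tr_tern].
Qed.
Fact sna_act (x : F) :
  {in sna_pred n F &, forall a b, x *: b - x *: a + a \in sna_pred n F}.
Proof.
move=> a b /andP[ga ta] /andP[gb tb]; apply/andP.
by split; [apply: gna_act | apply: tr_act].
Qed.
Fact sna_br : {in sna_pred n F &, forall a b, affine_commutator a b \in sna_pred n F}.
Proof.
move=> a b /andP[ga ta] /andP[gb tb]; apply/andP.
by split; [apply: gna_br | apply: tr_br].
Qed.


Fact ona_tern : {in ona_pred n R & &, forall a b c, a - b + c \in ona_pred n R}.
Proof.
move=> a b c; rewrite !onaE => /andP[ga /eqP ta] /andP[gb /eqP tb] /andP[gc /eqP tc].
apply/andP; split; first exact: line_sums_tern.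
by apply/eqP; rewrite linearD linearB /= ta tb tc; zmod.
Qed.
Fact ona_act (x : R) :
  {in ona_pred n R &, forall a b, x *: b - x *: a + a \in ona_pred n R}.
Proof.
move=> a b; rewrite !onaE => /andP[ga /eqP ta] /andP[gb /eqP tb].
apply/andP; split; first exact: line_sums_act.
by apply/eqP; rewrite linearD linearB /= !linearZ /= ta tb !(scalerDr, scalerN); zmod.
Qed.
Fact ona_br : {in ona_pred n R &, forall a b, affine_commutator a b \in ona_pred n R}.
Proof.
move=> a b; rewrite !onaE => /andP[ga /eqP ta] /andP[gb /eqP tb].
apply/andP; split; first exact: line_sums_br.
apply/eqP; rewrite linearD linearB /= !trmx_mul ta tb.
by rewrite !(mulmxDl, mulmxDr, mulmxN, mulNmx, mul1mx, mulmx1) /affine_commutator; zmod.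
Qed.

Fact una_tern : {in una_pred n R & &, forall a b c, a - b + c \in una_pred n R}.
Proof.
move=> a b c; rewrite !unaE => /andP[ga /eqP ta] /andP[gb /eqP tb] /andP[gc /eqP tc].
apply/andP; split; first exact: line_sums_tern.
by apply/eqP; rewrite linearD linearB /= !(map_mxD, map_mxN) ta tb tc; zmod.
Qed.
Fact antihermZ (x : R) m (a : 'M[R[i]]_m) :
  map_mx conjc (x%:C%C *: a)^T = x%:C%C *: map_mx conjc a^T.
Proof. by rewrite linearZ /= map_mxZ /= oppr0. Qed.
Fact una_act (x : R) :
  {in una_pred n R &, forall a b, x *: b - x *: a + a \in una_pred n R}.
Proof.
move=> a b; rewrite !unaE => /andP[ga /eqP ta] /andP[gb /eqP tb].
apply/andP; split; first exact: line_sums_act.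
apply/eqP; rewrite linearD linearB /= !(map_mxD, map_mxN) !antihermZ ta tb.
by rewrite !scalerN; zmod.
Qed.
Fact una_br : {in una_pred n R &, forall a b, affine_commutator a b \in una_pred n R}.
Proof.
move=> a b; rewrite !unaE => /andP[ga /eqP ta] /andP[gb /eqP tb].
apply/andP; split; first exact: line_sums_br.
apply/eqP; rewrite linearD linearB /= !trmx_mul !(map_mxD, map_mxN, map_mxM) ta tb.
by rewrite !(mulmxN, mulNmx) /affine_commutator; zmod.
Qed.

Fact suna_tern : {in suna_pred n R & &, forall a b c, a - b + c \in suna_pred n R}.
Proof.
move=> a b c /andP[ga ta] /andP[gb tb] /andP[gc tc]; apply/andP.
by split; [apply: una_tern | apply: tr_tern].
Qed.
Fact suna_act (x : R) :
  {in suna_pred n R &, forall a b, x *: b - x *: a + a \in suna_pred n R}.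
Proof.
move=> a b /andP[ga ta] /andP[gb tb]; apply/andP.
by split; [apply: una_act | apply: tr_act].
Qed.
Fact suna_br : {in suna_pred n R &, forall a b, affine_commutator a b \in suna_pred n R}.
Proof.
move=> a b /andP[ga ta] /andP[gb tb]; apply/andP.
by split; [apply: una_br | apply: tr_br].
Qed.

Definition gna : lieAffgebraType F := asub_type (AffSubset gna_tern gna_act gna_br).
Definition sna : lieAffgebraType F := asub_type (AffSubset sna_tern sna_act sna_br).
Definition ona : lieAffgebraType R := asub_type (AffSubset ona_tern ona_act ona_br).
Definition una : lieAffgebraType R := asub_type (AffSubset una_tern una_act una_br).
Definition suna : lieAffgebraType R :=
  asub_type (AffSubset suna_tern suna_act suna_br).

Fact gl_submod : submod_closed (gl_pred n F).
Proof. by []. Qed.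
Fact gl_comm : {in gl_pred n F &, forall a b, commutator a b \in gl_pred n F}.
Proof. by []. Qed.

Fact sl_submod : submod_closed (sl_pred n F).
Proof.
split; first by rewrite unfold_in linear0.
by move=> x a b; rewrite !unfold_in => /eqP a0 /eqP b0; rewrite linearP /= a0 b0
  mulr0 addr0.
Qed.
Fact sl_comm : {in sl_pred n F &, forall a b, commutator a b \in sl_pred n F}.
Proof. by move=> a b _ _; apply/eqP/tr_comm. Qed.

Fact o_submod : submod_closed (o_pred n R).
Proof.
split; first by rewrite unfold_in linear0 oppr0.
move=> x a b; rewrite !unfold_in => /eqP ta /eqP tb; apply/eqP.
by rewrite linearP /= ta tb scalerN opprD.
Qed.
Fact o_comm : {in o_pred n R &, forall a b, commutator a b \in o_pred n R}.
Proof.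
move=> a b /eqP ta /eqP tb; apply/eqP.
by rewrite linearB /= !trmx_mul ta tb !(mulmxN, mulNmx) /commutator; zmod.
Qed.

Fact u_submod : submod_closed (u_pred n R).
Proof.
split; first by rewrite unfold_in linear0 map_mx0 oppr0.
move=> x a b; rewrite !unfold_in => /eqP ta /eqP tb; apply/eqP.
by rewrite linearD map_mxD antihermZ ta tb scalerN opprD.
Qed.
Fact u_comm : {in u_pred n R &, forall a b, commutator a b \in u_pred n R}.
Proof.
move=> a b /eqP ta /eqP tb; apply/eqP; rewrite linearB /= !trmx_mul.
by rewrite !(map_mxD, map_mxN, map_mxM) ta tb !(mulmxN, mulNmx) /commutator; zmod.
Qed.

Fact su_submod : submod_closed (su_pred n R).
Proof.
have [u0 uP] := u_submod; split; first by apply/andP; rewrite linear0.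
move=> x a b /andP[ua /eqP ta] /andP[ub /eqP tb]; apply/andP; split.
  exact: uP.
by rewrite linearD linearZ /= ta tb mulr0 addr0.
Qed.
Fact su_comm : {in su_pred n R &, forall a b, commutator a b \in su_pred n R}.
Proof.
move=> a b /andP[ua _] /andP[ub _]; apply/andP; split; first exact: u_comm.
by apply/eqP/tr_comm.
Qed.

Definition lie_gl : lieAlgType F := lsub_type (LieSubset gl_submod gl_comm).
Definition lie_sl : lieAlgType F := lsub_type (LieSubset sl_submod sl_comm).
Definition lie_o : lieAlgType R := lsub_type (LieSubset o_submod o_comm).
Definition lie_u : lieAlgType R := lsub_type (LieSubset u_submod u_comm).
Definition lie_su : lieAlgType R := lsub_type (LieSubset su_submod su_comm).

End Examples.

(* Main.v *)
Require Import Defs.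
From HB Require Import structures.
From mathcomp Require Import all_boot all_order all_algebra.
From mathcomp Require Import complex reals ring.

Set Implicit Arguments.
Unset Strict Implicit.
Unset Printing Implicit Defensive.

Import Order.TTheory GRing.Theory Num.Theory.
Local Open Scope ring_scope.

(** Expanding the retract bracket of the affine commutator, all terms of degree
    one cancel except the base point, and what is left is
    [a, b]_o - o = (a - o)(b - o) - (b - o)(a - o).  Hence a |-> a - o turns the
    retract at o into the space D of directions x, those with x + o in the
    affine subset, equipped with the ordinary commutator.

    In each of the five cases D consists of matrices x of size n + 1 whose line
    sums all vanish, that is x 1 = 0 and 1^T x = 0 for the all-ones vector 1;
    the sum s prescribed by the affgebra (1 or i) cancels.  If n + 1 is
    invertible, the whole space is the direct sum of the line spanned by 1 and
    the hyperplane of vectors with coordinate sum zero, and x is nothing but an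
    endomorphism of that hyperplane, extended by zero to the line.  Concretely,
    choose Q whose columns form a basis of the hyperplane and P the coordinate
    map that kills 1 ([zero_sum_frame]).  Then P Q = 1, and Q P is the
    projection onto the hyperplane along 1 ([frame_proj]), so x |-> P x Q and
    y |-> Q y P are mutually inverse, multiplicative, and preserve the trace.
    This settles gl and sl.

    For the anti-symmetric and anti-hermitian cases the isomorphism must also
    commute with the adjoint, and for this the basis has to be orthonormal, with
    P = Q^T.  Such a real basis exists because the square root of n + 1 does
    ([exists_orthonormal_frame]); read as a complex matrix, it is fixed by
    conjugation and therefore serves the unitary cases as well. *)

(** * Retracts and spaces of directions *)

(** D is the space of directions of the affine subset: the isomorphism is
    a |-> f (a - o).  That f is linear on all of M spares an
    lmodType structure on D. *)
Lemma retract_iso (F : fieldType) (M N : assocAlgType F)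
    (S : affSubset M) (T : lieSubset N) (o : asub_type S) (D : {pred M})
    (f : M -> N) (g : N -> M) :
  (forall x, (x + val o \in S) = (x \in D)) ->
  linear f ->
  {in D &, forall x y, f (commutator x y) = commutator (f x) (f y)} ->
  {in D, forall x, f x \in T} -> {in T, forall y, g y \in D} ->
  {in D, cancel f g} -> {in T, cancel g f} ->
  lie_isomorphic (retract o) (lsub_type T).
Proof.
move=> SD flin fcomm fT gD fK gK.
have dirP (a : asub_type S) : val a - val o \in D by rewrite -SD subrK; exact: valP.
pose phi (a : retract o) : lsub_type T :=
  Sub (f (val (a : asub_type S) - val o)) (fT _ (dirP a)).
have psiP (y : lsub_type T) : g (val y) + val o \in S.
  by rewrite SD gD //; exact: valP.
pose psi (y : lsub_type T) : retract o :=
  Sub (g (val y) + val o) (psiP y) : asub_type S.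
have phi_lin : linear phi.
  move=> k a b; apply: val_inj; rewrite /= -flin; congr f.
  by rewrite /= scalerBr; zmod.
pose phiL := GRing.isLinear.Build F (retract o) (lsub_type T) _ phi phi_lin.
pose phi' : {linear retract o -> lsub_type T} := HB.pack phi phiL.
exists phi'; split.
  exists psi => [a|y]; apply: val_inj => /=.
    by rewrite fK ?dirP // subrK.
  by rewrite -[RHS]gK ?(valP y) //; congr f; apply: addrK.
move=> a b; apply: val_inj; rewrite /= -fcomm; [congr f | exact: dirP | exact: dirP].
by rewrite /affine_commutator /commutator !amulE; zmod.
Qed.

(** * Matrices with vanishing line sums *)

Lemma zero_sumP (K : pzRingType) m (x : 'M[K]_m) :
  reflect ((const_mx 1 : 'rV_m) *m x = 0 /\ x *m (const_mx 1 : 'cV_m) = 0)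
    (x \in line_sums 0).
Proof.
have c0 p q : const_mx 0 = 0 :> 'M[K]_(p, q).
  by apply/matrixP => i j; rewrite !mxE.
by have := line_sumsP 0 x; rewrite !c0.
Qed.

Lemma line_sums_direction (K : pzRingType) m (s : K) (o x : 'M[K]_m) :
  o \in line_sums s -> (x + o \in line_sums s) = (x \in line_sums 0).
Proof.
move=> /line_sumsP[o1 o2].
apply/line_sumsP/zero_sumP; rewrite mulmxDl mulmxDr o1 o2.
  by move=> [h1 h2]; split; apply: (addIr (const_mx s)); rewrite add0r.
by move=> [-> ->]; rewrite !add0r.
Qed.

Lemma mul_const_mx (K : pzRingType) m n p (a b : K) :
  (const_mx a : 'M_(m, n)) *m (const_mx b : 'M_(n, p)) = const_mx (n%:R * (a * b)).
Proof.
apply/matrixP => i j; rewrite !mxE (eq_bigr (fun=> a * b)).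
  by rewrite sumr_const card_ord mulr_natl.
by move=> k _; rewrite !mxE.
Qed.

(** The columns of Q are a basis of the hyperplane of vectors with coordinate
    sum zero, and P reads off the coordinates in it, annihilating the all-ones
    vector. *)
Definition zero_sum_frame (K : fieldType) n
    (P : 'M[K]_(n, n.+1)) (Q : 'M[K]_(n.+1, n)) : Prop :=
  [/\ P *m Q = 1%:M, P *m const_mx 1 = 0 :> 'cV_n & const_mx 1 *m Q = 0 :> 'rV_n].

Section Frame.
Variables (K : fieldType) (n : nat) (P : 'M[K]_(n, n.+1)) (Q : 'M[K]_(n.+1, n)).
Hypotheses (n1_neq0 : n.+1%:R != 0 :> K) (frPQ : zero_sum_frame P Q).

(** Bordering P with the row 1^T / (n + 1) and Q with the column 1 gives square
    matrices whose product is the identity; the claim is their product in the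
    other order. *)
Lemma frame_proj : Q *m P =
  1%:M - n.+1%:R^-1 *: ((const_mx 1 : 'cV_n.+1) *m (const_mx 1 : 'rV_n.+1)).
Proof.
have [PQ P1 Q1] := frPQ.
pose u : 'cV[K]_n.+1 := const_mx 1.
pose v : 'rV[K]_n.+1 := n.+1%:R^-1 *: const_mx 1.
have vu : v *m u = 1%:M.
  rewrite -scalemxAl mul_const_mx; apply/matrixP => i j.
  by rewrite !ord1 !mxE eqxx !mulr1 mulVf.
have : col_mx v P *m row_mx u Q = 1%:M.
  by rewrite mul_col_row vu PQ P1 -scalemxAl Q1 scaler0 -scalar_mx_block.
move/mulmx1C; rewrite mul_row_col => <-.
by rewrite -scalemxAr addrAC subrr add0r.
Qed.

Definition compress (x : 'M[K]_n.+1) : 'M[K]_n := P *m x *m Q.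
Definition expand (y : 'M[K]_n) : 'M[K]_n.+1 := Q *m y *m P.

Lemma mul_zero_sum_proj x : x \in line_sums 0 -> x *m (Q *m P) = x.
Proof.
by case/zero_sumP=> _ x1; rewrite frame_proj mulmxBr mulmx1 -scalemxAr mulmxA x1
  mul0mx scaler0 subr0.
Qed.

Lemma proj_mul_zero_sum x : x \in line_sums 0 -> Q *m P *m x = x.
Proof.
by case/zero_sumP=> x1 _; rewrite frame_proj mulmxBl mul1mx -scalemxAl -mulmxA x1
  mulmx0 scaler0 subr0.
Qed.

Lemma expand_zero_sum y : expand y \in line_sums 0.
Proof.
have [_ P1 Q1] := frPQ.
apply/zero_sumP; rewrite /expand; split; first by rewrite !mulmxA Q1 !mul0mx.
by rewrite -!mulmxA P1 !mulmx0.
Qed.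

Lemma compressK : {in line_sums 0, cancel compress expand}.
Proof.
move=> x x0; rewrite /expand /compress -!mulmxA mul_zero_sum_proj // mulmxA.
exact: proj_mul_zero_sum.
Qed.

Lemma expandK : cancel expand compress.
Proof.
have [PQ _ _] := frPQ.
by move=> y; rewrite /expand /compress !mulmxA PQ mul1mx -mulmxA PQ mulmx1.
Qed.

(** The projection Q P between P x Q and P y Q is absorbed by x, so a zero line
    sum is needed on one factor only. *)
Lemma compress_mul x y : x \in line_sums 0 ->
  compress (x *m y) = compress x *m compress y.
Proof.
by move=> x0; rewrite /compress -[in LHS](mul_zero_sum_proj x0) !mulmxA.
Qed.

Lemma compress_comm : {in line_sums 0 &, forall x y,
  compress (x *m y - y *m x) = compress x *m compress y - compress y *m compress x}.
Proof.
by move=> x y x0 y0; rewrite -!compress_mul // /compress mulmxBr mulmxBl.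
Qed.

Lemma tr_compress x : x \in line_sums 0 -> \tr (compress x) = \tr x.
Proof.
by move=> x0; rewrite /compress mxtrace_mulC mulmxA proj_mul_zero_sum.
Qed.

Lemma tr_expand y : \tr (expand y) = \tr y.
Proof. by rewrite -tr_compress ?expand_zero_sum // expandK. Qed.

Lemma compress_linear : linear compress.
Proof.
by move=> k x y; rewrite /compress mulmxDr mulmxDl -scalemxAr -scalemxAl.
Qed.

End Frame.

(** * Existence of frames *)

(** A basis of the hyperplane symmetric under permutations of the last n
    coordinates consists of vectors c e_0 + e_k + d (e_1 + ... + e_n); the
    coordinate functionals are sought in the same shape. *)
Definition block_row (K : fieldType) n (p e : K) : 'M[K]_(n, n.+1) :=
  row_mx (const_mx p : 'cV_n) (1%:M + const_mx e).
Definition block_col (K : fieldType) n (c d : K) : 'M[K]_(n.+1, n) :=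
  col_mx (const_mx c : 'rV_n) (1%:M + const_mx d).

Lemma block_frame (K : fieldType) n (p e c d : K) :
  p * c + d + e + n%:R * (e * d) = 0 -> p + 1 + n%:R * e = 0 ->
  c + 1 + n%:R * d = 0 -> zero_sum_frame (block_row n p e) (block_col n c d).
Proof.
move=> hPQ hP hQ; rewrite /block_row /block_col; split.
- rewrite [LHS](@mul_row_col K n 1 n _) mulmxDl !mulmxDr !mul1mx !mulmx1.
  rewrite !mul_const_mx mul1r.
  apply/matrixP => i j; rewrite !mxE.
  by rewrite -[RHS]addr0 -hPQ; ring.
- have -> : const_mx 1 = col_mx (const_mx 1) (const_mx 1) :> 'cV[K]_(1 + n).
    by rewrite col_mx_const.
  rewrite [LHS](@mul_row_col K n 1 n _) mulmxDl.
  rewrite mul1mx !mul_const_mx; apply/matrixP => i j; rewrite !mxE -[RHS]hP; ring.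
have -> : const_mx 1 = row_mx (const_mx 1) (const_mx 1) :> 'rV[K]_(1 + n).
  by rewrite row_mx_const.
rewrite [LHS](@mul_row_col K 1 1 n _) mulmxDr.
rewrite mulmx1 !mul_const_mx; apply/matrixP => i j; rewrite !mxE -[RHS]hQ; ring.
Qed.

(** With c = -1 and d = 0 the basis consists of the vectors e_k - e_0. *)
Lemma exists_frame (K : fieldType) n : n.+1%:R != 0 :> K ->
  exists (P : 'M[K]_(n, n.+1)) (Q : 'M[K]_(n.+1, n)), zero_sum_frame P Q.
Proof.
move=> n1; exists (block_row n (- n.+1%:R^-1) (- n.+1%:R^-1)).
exists (block_col n (-1) 0); apply: block_frame; first by ring.
  by field; rewrite addrC natr1.
by ring.
Qed.

(** Orthonormality asks for c^2 + 2 d + n d^2 = 0 besides c + 1 + n d = 0; the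
    solution is c = - 1 / s and d = - 1 / (s (s + 1)) with s^2 = n + 1. *)
Lemma exists_orthonormal_frame (K : rcfType) n :
  exists Q : 'M[K]_(n.+1, n), zero_sum_frame Q^T Q.
Proof.
pose s : K := Num.sqrt n.+1%:R.
have s_gt0 : 0 < s by rewrite sqrtr_gt0 ltr0Sn.
have s2 : s ^+ 2 = n%:R + 1 by rewrite sqr_sqrtr ?ler0n // natr1.
have s0 : s != 0 by rewrite gt_eqF.
have s1 : s + 1 != 0 by rewrite gt_eqF // addr_gt0 ?ltr01.
have nE : n%:R = s ^+ 2 - 1 by rewrite s2 addrK.
exists (block_col n (- s^-1) (- (s * (s + 1))^-1)).
have -> : (block_col n (- s^-1) (- (s * (s + 1))^-1))^T =
    block_row n (- s^-1) (- (s * (s + 1))^-1).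
  by rewrite /block_col [LHS](@tr_col_mx K 1 n n) linearD /= !trmx_const trmx1.
by apply: block_frame; rewrite ?nE; field; rewrite s0 s1.
Qed.

Lemma zero_sum_frame_map (K L : fieldType) (h : {rmorphism K -> L}) n
    (P : 'M[K]_(n, n.+1)) (Q : 'M[K]_(n.+1, n)) :
  zero_sum_frame P Q -> zero_sum_frame (map_mx h P) (map_mx h Q).
Proof.
case=> PQ P1 Q1; have c1 p q : const_mx 1 = map_mx h (const_mx 1) :> 'M[L]_(p, q).
  by rewrite map_const_mx rmorph1.
by split; rewrite ?c1 -map_mxM ?PQ ?P1 ?Q1 (map_mx1, map_mx0).
Qed.

(** * The isomorphisms *)

Lemma zero_sum_retract_iso (K : fieldType) n
    (P : 'M[K]_(n, n.+1)) (Q : 'M[K]_(n.+1, n))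
    (S : affSubset 'M[K]_n.+1) (T : lieSubset 'M[K]_n) (o : asub_type S)
    (D : {pred 'M[K]_n.+1}) :
  n.+1%:R != 0 :> K -> zero_sum_frame P Q ->
  (forall x, (x + val o \in S) = (x \in line_sums 0) && (x \in D)) ->
  {in line_sums 0, forall x, x \in D -> compress P Q x \in T} ->
  {in T, forall y, expand P Q y \in D} ->
  lie_isomorphic (retract o) (lsub_type T).
Proof.
move=> n1 frPQ SD DT TD.
apply: (retract_iso (D := [predI line_sums 0 & D]) SD).
- exact: compress_linear.
- by move=> x y /andP[x0 _] /andP[y0 _]; apply: compress_comm.
- by move=> x /andP[]; apply: DT.
- by move=> y yT; apply/andP; split; [apply: expand_zero_sum | apply: TD].
- by move=> x /andP[x0 _]; apply: compressK.
- by move=> y _; apply: expandK.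
Qed.

(** The scalars of [cmatrix] are real while the frame is complex, which is why
    this is not an instance of [zero_sum_retract_iso]. *)
Lemma zero_sum_retract_iso_complex (R : realType) n (P : 'M[R[i]%C]_(n, n.+1))
    (Q : 'M[R[i]%C]_(n.+1, n)) (S : affSubset (cmatrix R n.+1))
    (T : lieSubset (cmatrix R n)) (o : asub_type S) (D : {pred cmatrix R n.+1}) :
  zero_sum_frame P Q ->
  (forall x : cmatrix R n.+1, (x + val o \in S) =
    ((x : 'M[R[i]%C]_n.+1) \in line_sums 0) && (x \in D)) ->
  {in line_sums 0, forall x, x \in D -> compress P Q x \in T} ->
  {in T, forall y, expand P Q y \in D} ->
  lie_isomorphic (retract o) (lsub_type T).
Proof.
move=> frPQ SD DT TD.
have n1 : n.+1%:R != 0 :> R[i]%C by rewrite pnatr_eq0.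
apply: (@retract_iso _ _ _ _ _ o [predI line_sums 0 & D]
  (compress P Q : cmatrix R n.+1 -> cmatrix R n) (expand P Q)).
- exact: SD.
- by move=> k x y; apply: compress_linear.
- by move=> x y /andP[x0 _] /andP[y0 _]; apply: compress_comm.
- by move=> x /andP[]; apply: DT.
- by move=> y yT; apply/andP; split; [apply: expand_zero_sum | apply: TD].
- by move=> x /andP[x0 _]; apply: compressK.
- by move=> y _; apply: expandK.
Qed.

(** The affine condition a^T = 2 - a has the linear part x^T = - x. *)
Lemma ona_direction n (R : realType) (o x : 'M[R]_n.+1) : o \in ona_pred n R ->
  (x + o \in ona_pred n R) = (x \in line_sums 0) && (x \in o_pred n.+1 R).
Proof.
rewrite !onaE => /andP[go /eqP to]; rewrite -(line_sums_direction x go).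
congr (_ && _); rewrite [RHS]unfold_in linearD /= to -subr_eq0 -[RHS]subr_eq0.
by congr (_ == _); zmod.
Qed.

Lemma una_direction n (R : realType) (o x : cmatrix R n.+1) : o \in una_pred n R ->
  (x + o \in una_pred n R) =
  ((x : 'M[R[i]%C]_n.+1) \in line_sums 0) && (x \in u_pred n.+1 R).
Proof.
rewrite !unaE => /andP[go /eqP to]; rewrite -(line_sums_direction x go).
congr (_ && _); rewrite [RHS]unfold_in linearD map_mxD /= to.
rewrite -subr_eq0 -[RHS]subr_eq0.
by congr (_ == _); zmod.
Qed.

Section OrthonormalFrame.
Variables (R : realType) (n : nat) (Q : 'M[R]_(n.+1, n)).

(** P = Q^T makes transposition commute with x |-> P x Q. *)
Lemma compress_antisym :
  {in o_pred n.+1 R, forall x, compress Q^T Q x \in o_pred n R}.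
Proof.
move=> x /eqP tx; apply/eqP.
by rewrite /compress !trmx_mul trmxK tx !(mulmxN, mulNmx) mulmxA.
Qed.

Lemma expand_antisym :
  {in o_pred n R, forall y, expand Q^T Q y \in o_pred n.+1 R}.
Proof.
move=> y /eqP ty; apply/eqP.
by rewrite /expand !trmx_mul trmxK ty !(mulmxN, mulNmx) mulmxA.
Qed.

Let QC : 'M[R[i]%C]_(n.+1, n) := map_mx (real_complex R) Q.

Let conjQ : map_mx conjc QC = QC.
Proof. by apply/matrixP => i j; rewrite !mxE /= oppr0. Qed.

Lemma compress_antiherm :
  {in u_pred n.+1 R, forall x, compress QC^T QC x \in u_pred n R}.
Proof.
move=> x /eqP tx; apply/eqP; rewrite /compress !trmx_mul trmxK !map_mxM tx.
by rewrite -[map_mx conjc QC^T]map_trmx conjQ !(mulmxN, mulNmx) mulmxA.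
Qed.

Lemma expand_antiherm :
  {in u_pred n R, forall y, expand QC^T QC y \in u_pred n.+1 R}.
Proof.
move=> y /eqP ty; apply/eqP; rewrite /expand !trmx_mul trmxK !map_mxM ty.
by rewrite -[map_mx conjc QC^T]map_trmx conjQ !(mulmxN, mulNmx) mulmxA.
Qed.

End OrthonormalFrame.

(* [hdvd] reads "n <> char(F) - 1" modulo char(F): the first two isomorphisms
   fail when char(F) divides n + 1, e.g. for F = 'F_2 and n = 3. *)
Theorem corollary3p3 (F : fieldType) (R : realType) (n : nat)
    (hn : (0 < n)%N)
    (hchar : n \notin [pchar F])
    (hchar1 : n.+1 \notin [pchar F])
    (hdvd : n.+1%:R != 0 :> F) :
  [/\ forall o : gna n F, lie_isomorphic (retract o) (lie_gl n F),
      forall o : sna n F, lie_isomorphic (retract o) (lie_sl n F),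
      forall o : ona n R, lie_isomorphic (retract o) (lie_o n R),
      forall o : una n R, lie_isomorphic (retract o) (lie_u n R)
    & forall o : suna n R, lie_isomorphic (retract o) (lie_su n R)].
Proof.
have [P [Q frPQ]] := exists_frame hdvd.
have [V frV] := exists_orthonormal_frame R n.
have nR : n.+1%:R != 0 :> R by rewrite pnatr_eq0.
have nC : n.+1%:R != 0 :> R[i]%C by rewrite pnatr_eq0.
pose VC := map_mx (real_complex R) V.
have frVC : zero_sum_frame VC^T VC.
  by rewrite /VC map_trmx; apply: zero_sum_frame_map.
split=> o.
- apply: (zero_sum_retract_iso (D := gl_pred n.+1 F) hdvd frPQ) => // x.
  by rewrite andbT; apply: line_sums_direction; exact: (valP o).
- have /andP[go /eqP to] := valP o.
  apply: (zero_sum_retract_iso (D := sl_pred n.+1 F) hdvd frPQ).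
  + move=> x; rewrite -(line_sums_direction x go).
    by congr (_ && _); rewrite raddfD /= to addr0.
  + by move=> x x0; rewrite !unfold_in /sl_pred tr_compress.
  + by move=> y; rewrite !unfold_in /sl_pred tr_expand.
- apply: (zero_sum_retract_iso (D := o_pred n.+1 R) nR frV).
  + by move=> x; apply: ona_direction; exact: (valP o).
  + by move=> x _; apply: compress_antisym.
  + exact: expand_antisym.
- apply: (zero_sum_retract_iso_complex (D := u_pred n.+1 R) frVC).
  + by move=> x; apply: una_direction; exact: (valP o).
  + by move=> x _; apply: compress_antiherm.
  + exact: expand_antiherm.
have /andP[uo /eqP to] := valP o.
apply: (zero_sum_retract_iso_complex (D := su_pred n.+1 R) frVC).
- move=> x; rewrite [RHS]andbA -(una_direction x uo).
  by congr (_ && _); rewrite raddfD /= to addr0.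
- move=> x x0 /andP[ux tx]; apply/andP.
  by rewrite compress_antiherm // tr_compress.
move=> y /andP[uy ty]; apply/andP.
by rewrite expand_antiherm // tr_expand.
Qed.
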